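(* Let $K$ be a field, $n\ge 1$ and $q\ge 2$ integers, and let $\mathcal{A}$ be a maximal D$_q$ subalgebra of $\mathrm{M}_n(K)$. Then there exists an invertible matrix $X\in \mathrm{M}_n(K)$ such that $X^{-1}\mathcal{A}X$ is a D$_q$ subalgebra of $\mathrm{M}_n(K)$ of type $(n_1,n_2,\ldots,n_q)$ with max-comm db's, for some positive integers $n_1,\ldots,n_q$ with $n_1+\cdots+n_q=n$.
   Context: All algebras are associative and unital over the field $K$; a subalgebra of $\mathrm{M}_n(K)$ is a (unital) $K$-subalgebra. $[x,y]=xy-yx$. An algebra is D$_q$ if it satisfies the identity $[x_1,y_1][x_2,y_2]\cdots[x_q,y_q]=0$. Convention: whenever a D$_q$ subalgebra of $\mathrm{M}_n(K)$ is considered, it is assumed that $q\ge 2$ and that it is not D$_{q-1}$. A maximal D$_q$ subalgebra of $\mathrm{M}_n(K)$ is a D$_q$ subalgebra that is maximal with respect to inclusion among D$_q$ subalgebras of $\mathrm{M}_n(K)$. For positive integers $n_1,\ldots,n_q$ ($q\ge 2$) with $n_1+\cdots+n_q=n$, view matrices in $\mathrm{M}_n(K)$ as $q\times q$ block matrices whose $(i,j)$ block has size $n_i\times n_j$. A subalgebra $\mathcal{A}$ of $\mathrm{M}_n(K)$ is of type $(n_1,\ldots,n_q)$ if there are subalgebras $\mathcal{A}_{ii}$ of $\mathrm{M}_{n_i}(K)$, $i=1,\ldots,q$ (its diagonal blocks), such that $\mathcal{A}$ consists of exactly all block matrices whose $(i,i)$ block lies in $\mathcal{A}_{ii}$ (independently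 for each $i$), whose $(i,j)$ block is an arbitrary element of $\mathrm{M}_{n_i\times n_j}(K)$ for $i<j$, and whose $(i,j)$ block is zero for $i>j$. It is a D$_q$ subalgebra of $\mathrm{M}_n(K)$ of type $(n_1,\ldots,n_q)$ with max-comm db's if, moreover, every $\mathcal{A}_{ii}$ is a maximal commutative subalgebra of $\mathrm{M}_{n_i}(K)$. *)

(* Defs.v *)
From mathcomp Require Import all_boot all_order all_algebra.

Set Implicit Arguments.
Unset Strict Implicit.
Unset Printing Implicit Defensive.

Import GRing.Theory.
Local Open Scope ring_scope.

(* Falgebra's {aspace _} is not used here: it needs a nontrivial ring, hence
   sizes of the form n.+1 (block sizes are not), and its spaces need not
   contain 1%:M. *)
Definition is_subalgebra (K : fieldType) (n : nat) (A : {vspace 'M[K]_n}) :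
    Prop :=
  1%:M \in A /\ forall x y, x \in A -> y \in A -> x *m y \in A.

Definition commutator (K : fieldType) (n : nat) (x y : 'M[K]_n) : 'M[K]_n :=
  x *m y - y *m x.

Definition satisfies_D (K : fieldType) (n q : nat) (A : {vspace 'M[K]_n}) :
    Prop :=
  forall x y : 'I_q -> 'M[K]_n,
    (forall i, x i \in A) -> (forall i, y i \in A) ->
    \prod_(i < q) commutator (x i) (y i) = 0.

(* The conditions 1 < q and "not D_(q-1)" are part of the convention on what is
   called a D_q subalgebra. *)
Definition is_D_subalgebra (K : fieldType) (n q : nat)
    (A : {vspace 'M[K]_n}) : Prop :=
  [/\ (1 < q)%N, is_subalgebra A, satisfies_D q A & ~ satisfies_D q.-1 A].

Definition is_commutative_subalgebra (K : fieldType) (n : nat)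
    (A : {vspace 'M[K]_n}) : Prop :=
  is_subalgebra A /\ forall x y, x \in A -> y \in A -> x *m y = y *m x.

Definition is_maximal (K : fieldType) (n : nat)
    (P : {vspace 'M[K]_n} -> Prop) (A : {vspace 'M[K]_n}) : Prop :=
  P A /\ forall B : {vspace 'M[K]_n}, P B -> (A <= B)%VS -> B = A.

Definition is_maximal_D_subalgebra (K : fieldType) (n q : nat)
    (A : {vspace 'M[K]_n}) : Prop :=
  is_maximal (is_D_subalgebra q) A.

Definition is_maximal_commutative_subalgebra (K : fieldType) (n : nat)
    (A : {vspace 'M[K]_n}) : Prop :=
  is_maximal (@is_commutative_subalgebra K n) A.

Definition block (K : fieldType) (n q : nat) (d : 'I_q -> nat)
    (e : (\sum_i d i)%N = n) (M : 'M[K]_n) (i j : 'I_q) : 'M[K]_(d i, d j) :=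
  submxblock (castmx (esym e, esym e) M) i j.

Definition has_type_with_blocks (K : fieldType) (n q : nat) (d : 'I_q -> nat)
    (e : (\sum_i d i)%N = n) (D : forall i, {vspace 'M[K]_(d i)})
    (A : {vspace 'M[K]_n}) : Prop :=
  [/\ (1 < q)%N, forall i, (0 < d i)%N, is_subalgebra A,
      forall i, is_subalgebra (D i)
    & forall M : 'M[K]_n,
        M \in A <->
        (forall i, block e M i i \in D i) /\
        (forall i j : 'I_q, (j < i)%N -> block e M i j = 0)].

Definition is_D_of_type_max_comm (K : fieldType) (n q : nat) (d : 'I_q -> nat)
    (e : (\sum_i d i)%N = n) (A : {vspace 'M[K]_n}) : Prop :=
  is_D_subalgebra q A /\
  exists D : forall i, {vspace 'M[K]_(d i)},
    has_type_with_blocks e D A /\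
    forall i, is_maximal_commutative_subalgebra (D i).

Definition conj_space (K : fieldType) (n : nat) (X : 'M[K]_n)
    (A : {vspace 'M[K]_n}) : {vspace 'M[K]_n} :=
  (linfun (mulmxr X \o mulmx (invmx X)) @: A)%VS.

(* linfun f is a junk value unless f is linear; here it is. *)
Lemma mem_conj_space (K : fieldType) (n : nat) (X : 'M[K]_n)
    (A : {vspace 'M[K]_n}) (M : 'M[K]_n) :
  M \in conj_space X A <-> exists2 N, N \in A & M = invmx X *m N *m X.
Proof.
split=> [/memv_imgP[N NA ->]|[N NA ->]]; first by exists N; rewrite // lfunE.
by apply/memv_imgP; exists N; rewrite // lfunE.
Qed.

(* Main.v *)
(* Let C be the span of the commutators of A.  Acting on row vectors, the spaces
   W_k = K^n C^k are A-stable because [x, y] z = [x, y z] - y [x, z].  They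
   decrease from W_0 = K^n to W_q = 0 by D_q, and strictly so, since
   W_k = W_(k+1) would give W_(q-1) = 0, that is D_(q-1).  In a basis adapted to
   this flag A is block upper triangular, and its diagonal blocks commute because
   W_k C = W_(k+1).  For any commutative subalgebras D_i containing the diagonal
   blocks of A, all block upper triangular matrices with diagonal blocks in the
   D_i form a D_q algebra containing A, hence equal to A.  Taking D_i to be the
   diagonal blocks of A gives the shape of A; enlarging a single D_i shows that
   it is maximal commutative. *)

Require Import Defs.
From HB Require Import structures.
From mathcomp Require Import all_boot all_order all_algebra.

Set Implicit Arguments.
Unset Strict Implicit.
Unset Printing Implicit Defensive.

Import GRing.Theory.

Local Open Scope ring_scope.

(* The row space of [comm_flag A k] is K^n C^k, C the span of the commutators
   of A. *)
Fixpoint comm_flag (K : fieldType) (n : nat) (A : {vspace 'M[K]_n}) (k : nat) :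
    'M[K]_n :=
  if k is k'.+1 then
    (\sum_(p : 'I_(\dim A) * 'I_(\dim A))
      comm_flag A k' *m commutator (vbasis A)`_p.1 (vbasis A)`_p.2)%MS
  else 1%:M.

(** * Stability and strict descent of the commutator flag *)

Section CommFlag.

Variables (K : fieldType) (n : nat) (A : {vspace 'M[K]_n}).
Local Notation W := (comm_flag A).

Lemma basis_mem (i : 'I_(\dim A)) : (vbasis A)`_i \in A.
Proof. by rewrite vbasis_mem // mem_nth // size_tuple. Qed.

Lemma comm_flagSP k p (Z : 'M_(p, n)) :
  reflect (forall i j : 'I_(\dim A),
             W k *m commutator (vbasis A)`_i (vbasis A)`_j <= Z)%MS
          (W k.+1 <= Z)%MS.
Proof.
apply: (iffP idP) => [/sumsmx_subP H i j | H]; first exact: (H (i, j)).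
by apply/sumsmx_subP => -[i j] _; apply: H.
Qed.

(** Commutators are bilinear, so those of basis vectors, which define the flag, control all of
    them. *)
Lemma comm_flag_commutator k x y :
  x \in A -> y \in A -> (W k *m commutator x y <= W k.+1)%MS.
Proof.
move=> xA yA.
have : exists a b : 'I_(\dim A) -> K, x = \sum_i a i *: (vbasis A)`_i
    /\ y = \sum_i b i *: (vbasis A)`_i.
  by exists (fun i => coord (vbasis A) i x), (fun i => coord (vbasis A) i y);
     split; apply: coord_vbasis.
case=> a [b [-> ->]].
have -> : commutator (\sum_i a i *: (vbasis A)`_i) (\sum_i b i *: (vbasis A)`_i)
  = \sum_i \sum_j (a i * b j) *: commutator (vbasis A)`_i (vbasis A)`_j.
  rewrite /commutator mulmx_suml mulmx_sumr -sumrB; apply: eq_bigr => i _.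
  rewrite mulmx_sumr mulmx_suml -sumrB; apply: eq_bigr => j _.
  by rewrite -!scalemxAl -!scalemxAr !scalerA [b j * _]mulrC -scalerBr.
rewrite mulmx_sumr summx_sub // => i _; rewrite mulmx_sumr summx_sub // => j _.
by rewrite -scalemxAr scalemx_sub //; apply/comm_flagSP.
Qed.

Hypothesis algA : is_subalgebra A.

Lemma comm_flag_stable k x : x \in A -> (W k *m x <= W k)%MS.
Proof.
have [_ mulA] := algA; elim: k x => [|k IHk] x xA; first exact: submx1.
rewrite [in X in (X <= _)%MS]/= sumsmxMr; apply/sumsmx_subP => -[i j] _ /=.
set u := _`_i; set v := _`_j.
have uA : u \in A by apply: basis_mem.
have vA : v \in A by apply: basis_mem.
(* The left factor [v] in the second term is absorbed by the induction hypothesis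
   [W k *m v <= W k]. *)
have -> : W k *m commutator u v *m x
        = W k *m commutator u (v *m x) - W k *m v *m commutator u x.
  by rewrite /commutator !(mulmxBl, mulmxBr) !mulmxA opprB addrA subrK.
rewrite addmx_sub ?eqmx_opp ?comm_flag_commutator ?mulA //.
by rewrite (submx_trans (submxMr _ (IHk v vA))) ?comm_flag_commutator.
Qed.

Lemma comm_flag_decr k : (W k.+1 <= W k)%MS.
Proof.
have [_ mulA] := algA; apply/comm_flagSP => i j.
by rewrite comm_flag_stable // rpredB // mulA ?basis_mem.
Qed.

Lemma comm_flag_homo j k : (j <= k)%N -> (W k <= W j)%MS.
Proof.
elim: k => [|k IHk]; first by rewrite leqn0 => /eqP ->.
rewrite leq_eqVlt => /predU1P[-> //|/IHk]; exact/submx_trans/comm_flag_decr.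
Qed.

(** The right factor [Z] lets the induction on [k] move the last commutator into it; [Z = 1] is the
    case of interest. Sequences are indexed by [nat] so that they can be extended. *)
Lemma comm_flag_mul_eq0 k (Z : 'M_n) :
  (forall x y : nat -> 'M_n, (forall i, x i \in A) -> (forall i, y i \in A) ->
     (\prod_(i < k) commutator (x i) (y i)) *m Z = 0) ->
  W k *m Z = 0.
Proof.
elim: k Z => [|k IHk] Z H.
  move: (H (fun=> 0) (fun=> 0)); rewrite big_ord0; apply=> _; exact: mem0v.
apply/sub_kermxP/comm_flagSP => i j; apply/sub_kermxP; rewrite -mulmxA.
apply: IHk => x y xA yA.
(* The commutator of the two basis vectors becomes the factor of index [k], the last one. *)
pose x' l := if (l < k)%N then x l else (vbasis A)`_i.
pose y' l := if (l < k)%N then y l else (vbasis A)`_j.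
have := H x' y'; rewrite big_ord_recr /= /x' /y' ltnn -mulmxE -mulmxA.
under eq_bigr do rewrite ltn_ord.
by apply=> l; case: ifP => // _; apply: basis_mem.
Qed.

Lemma comm_flag_D k : satisfies_D k A -> W k = 0.
Proof.
move=> DA; rewrite -[W k]mulmx1; apply: comm_flag_mul_eq0 => x y xA yA.
by rewrite (DA (x \o val) (y \o val)) ?mul0mx // => i /=.
Qed.

Lemma prod_commutator_sub k (x y : 'I_k -> 'M_n) :
  (forall i, x i \in A) -> (forall i, y i \in A) ->
  (\prod_(i < k) commutator (x i) (y i) <= W k)%MS.
Proof.
elim: k x y => [|k IHk] x y xA yA; first by rewrite big_ord0 submx_refl.
rewrite big_ord_recr /= -mulmxE.
by rewrite (submx_trans (submxMr _ (IHk _ _ _ _))) ?comm_flag_commutator.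
Qed.

Lemma comm_flag_eq0 k : W k = 0 -> satisfies_D k A.
Proof.
move=> Wk0 x y xA yA; apply/eqP; rewrite -submx0 -Wk0.
exact: prod_commutator_sub.
Qed.

(** Multiplying an inclusion of [W l] in [W l.+1] by commutators gives the next one, so a flag that
    stops once stops for good. *)
Lemma comm_flag_const j k : (W j <= W j.+1)%MS -> (j <= k)%N -> (W j <= W k)%MS.
Proof.
move=> Wj /subnK <-; elim: (k - j)%N => [|m IHm]; rewrite ?submx_refl //.
apply: (submx_trans IHm).
elim: (m) => [|l IHl] //; apply/comm_flagSP => i i'.
by rewrite (submx_trans (submxMr _ IHl)) // comm_flag_commutator ?basis_mem.
Qed.

Lemma comm_flag_proper q j :
  satisfies_D q A -> ~ satisfies_D q.-1 A -> (j < q)%N -> ~~ (W j <= W j.+1)%MS.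
Proof.
move=> DqA nDA ltjq; apply/negP => Wj; apply: nDA; apply: comm_flag_eq0.
apply/eqP; rewrite -submx0 -(comm_flag_D DqA).
(* If the flag stopped at [j], then [W q.-1 <= W j <= W q = 0]. *)
apply: (submx_trans (comm_flag_homo (_ : j <= q.-1)%N)).
  by rewrite -ltnS prednK // (leq_ltn_trans _ ltjq).
by rewrite comm_flag_const // ltnW.
Qed.

End CommFlag.

(** * Block decomposition of square matrices *)

Section Block.

Variables (K : fieldType) (n q : nat) (d : 'I_q -> nat).
Variable e : (\sum_i d i)%N = n.
Implicit Types (M N : 'M[K]_n) (i j : 'I_q).

(** The matrix comes last, so that the block map can be declared linear. *)
Definition block_at i j M := block e M i j.

Fact block_at_is_linear i j : linear (block_at i j).
Proof.
(* Eliminating [e] makes [n] the sum of the block sizes, and the cast disappears. *)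
rewrite /block_at; case: n / e => a M N; rewrite /block !castmx_id.
by apply/matrixP => k l; rewrite !mxE.
Qed.

HB.instance Definition _ i j :=
  GRing.isLinear.Build K 'M[K]_n 'M[K]_(d i, d j) _ (block_at i j)
    (block_at_is_linear i j).

Lemma block_mul M N i j :
  block e (M *m N) i j = \sum_k block e M i k *m block e N k j.
Proof.
case: n / e M N => M N; rewrite /block !castmx_id.
by rewrite -{1}[M]submxblockK -{1}[N]submxblockK mul_mxblock mxblockK.
Qed.

Lemma block1 i j : i != j -> block e (1%:M : 'M[K]_n) i j = 0.
Proof.
case: n / e => ij; rewrite /block castmx_id -mxdiagZ /mxdiag mxblockK.
by rewrite (negPf ij).
Qed.

Lemma block1_diag i : block e (1%:M : 'M[K]_n) i i = 1%:M.
Proof. by case: n / e; rewrite /block castmx_id -mxdiagZ submxblock_diag. Qed.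

Lemma block_eq0 M : (forall i j, block e M i j = 0) -> M = 0.
Proof.
case: n / e M => M; rewrite /block castmx_id => M0.
by rewrite -[M]submxblockK -mxblock0; apply: eq_mxblock.
Qed.

Lemma exists_diagonal (D : forall i, 'M[K]_(d i)) :
  exists M, (forall i, block e M i i = D i) /\
            (forall i j, i != j -> block e M i j = 0).
Proof.
case: n / e; exists (\mxdiag_i D i); rewrite /block castmx_id; split=> [i|i j ij].
  exact: submxblock_diag.
by rewrite /mxdiag mxblockK (negPf ij).
Qed.

(** Shifts of the block filtration add up: shift 0 is block upper triangular, shift 1 strictly so.
    In each term of the product either [h < i + k] or [j < h + l]. *)
Lemma block_mul_upper M N k l i j :
  (forall i j, (j < i + k)%N -> block e M i j = 0) ->
  (forall i j, (j < i + l)%N -> block e N i j = 0) ->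
  (j < i + (k + l))%N -> block e (M *m N) i j = 0.
Proof.
move=> M0 N0 ltj; rewrite block_mul big1 // => h _.
have [lth|leh] := ltnP h (i + k); first by rewrite M0 ?mul0mx.
by rewrite N0 ?mulmx0 // (leq_trans ltj) // addnA leq_add2r.
Qed.

Lemma block_mul_diag M N i :
  (forall i j, (j < i)%N -> block e M i j = 0) ->
  (forall i j, (j < i)%N -> block e N i j = 0) ->
  block e (M *m N) i i = block e M i i *m block e N i i.
Proof.
move=> M0 N0; rewrite block_mul (bigD1 i) //= big1 ?addr0 // => h hi.
have [lth|gth|/val_inj eqh] := ltngtP h i; first by rewrite M0 ?mul0mx.
  by rewrite N0 ?mulmx0.
by rewrite eqh eqxx in hi.
Qed.

Lemma block_prod_upper k (c : 'I_k -> 'M[K]_n) i j :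
  (forall l i j, (j < i + 1)%N -> block e (c l) i j = 0) ->
  (j < i + k)%N -> block e (\prod_l c l) i j = 0.
Proof.
elim: k c i j => [|k IHk] c i j c0 ltj.
  by rewrite big_ord0 block1 // -val_eqE gtn_eqF // -[val i]addn0.
rewrite big_ord_recr /= -mulmxE.
apply: (@block_mul_upper _ _ k 1) => [i' j'||]; rewrite ?addn1 //; last exact: c0.
by apply: IHk => l; apply: c0.
Qed.

End Block.

(* A basis adapted to the sum of the row spaces [B i]; the [P j] are the column
   blocks of its inverse. *)
Lemma exists_block_conj (K : fieldType) (n q : nat) (d : 'I_q -> nat)
    (e : (\sum_i d i)%N = n) (B : forall i, 'M[K]_(d i, n)) :
  (1%:M <= \sum_i <<B i>>)%MS ->
  exists2 X : 'M[K]_n, X \in unitmx &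
    exists P : forall j, 'M[K]_(n, d j),
      (forall i j, i != j -> B i *m P j = 0) /\
      forall M i j, block e (invmx X *m M *m X) i j = B i *m M *m P j.
Proof.
case: n / e B => B B1; pose Y := \mxcol_i B i.
have uY : Y \in unitmx by rewrite -row_full_unit -sub1mx eqmx_col.
have E (M : 'M_(\sum_i d i)) i j : block (erefl _) (Y *m M *m invmx Y) i j
    = B i *m M *m submxrow (invmx Y) j.
  rewrite /block castmx_id submxblockEh -mul_submxrow -!submxcol_mul.
  by rewrite mxcolK.
exists (invmx Y); first by rewrite unitmx_inv.
exists (submxrow (invmx Y)); split=> [i j ij|M i j]; last by rewrite invmxK E.
(* [B i *m P j] is the block at [(i, j)] of [Y *m invmx Y = 1]. *)
by rewrite -[B i]mulmx1 -E mulmx1 mulmxV // block1.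
Qed.

(** * Bases adapted to a descending flag *)

Lemma descending_ind (P : nat -> Prop) q :
  P q -> (forall k, (k < q)%N -> P k.+1 -> P k) -> forall k, (k <= q)%N -> P k.
Proof.
move=> Pq PS k /subnKC; move: (q - k)%N => m; elim: m k => [|m IHm] k.
  by rewrite addn0 => ->.
move=> E; apply: PS; first by rewrite -E addnS ltnS leq_addr.
by apply: IHm; rewrite addSnnS.
Qed.

(** The basis vectors of block [i] span a complement of [W i.+1] in [W i], so [W k] is spanned by
    the blocks of index at least [k]. Taking [k = i] will give triangularity, and [k = i.+1] the
    vanishing of diagonal blocks. *)
Lemma adapted_conj (K : fieldType) (n q : nat) (W : nat -> 'M[K]_n) :
  W 0 = 1%:M -> W q = 0 -> (forall k, (W k.+1 <= W k)%MS) ->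
  exists d : 'I_q -> nat, (forall i, d i = \rank (W i :\: W i.+1)%MS) /\
  exists e : (\sum_i d i)%N = n,
  exists2 X : 'M[K]_n, X \in unitmx &
  forall M (i j : 'I_q) k, (j < k <= q)%N -> (W i *m M <= W k)%MS ->
    block e (invmx X *m M *m X) i j = 0.
Proof.
move=> W0 Wq Wdecr; pose B k := row_base (W k :\: W k.+1)%MS.
exists (fun i : 'I_q => \rank (W i :\: W i.+1)%MS); split=> //.
have e : (\sum_(i < q) \rank (W i :\: W i.+1)%MS)%N = n.
  (* The ranks telescope. *)
  have H k : (\sum_(i < k) \rank (W i :\: W i.+1)%MS + \rank (W k))%N = n.
    elim: k => [|k IHk]; first by rewrite big_ord0 W0 mxrank1.
    rewrite big_ord_recr -[RHS]IHk -addnA /=; congr (_ + _)%N.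
    by rewrite -(mxrank_cap_compl (W k) (W k.+1)) addnC (capmx_idPr (Wdecr k)).
  by rewrite -[RHS](H q) Wq mxrank0 addn0.
have WB k : (W k <= B k + W k.+1)%MS.
  rewrite -(addsmx_diff_cap_eq (W k) (W k.+1)).
  by rewrite addsmxS ?capmxSr // eq_row_base.
exists e; have [|X uX [P [BP E]]] := exists_block_conj e (B := fun i => B i).
  (* From [W q = 0] upwards, every [W k] lies in the sum of the [B i]; [W 0] is the whole space. *)
  rewrite -W0; apply: (@descending_ind (fun k => W k <= _)%MS q) => [|k kq Wk|] //.
    by rewrite Wq sub0mx.
  rewrite (submx_trans (WB k)) // addsmx_sub Wk andbT.
  by rewrite (sumsmx_sup (Ordinal kq)) // genmxE.
exists X => // M i j k /andP[jk kq] WM.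
rewrite E; apply/sub_kermxP; apply: (submx_trans (submxMr M (_ : B i <= W i)%MS)).
  by rewrite eq_row_base diffmxSl.
(* It remains that [P j] kills [W k] for [k > j]: it kills each [B l] with [l > j], and these span
   [W k]. *)
apply: (submx_trans WM); move: jk.
apply: (descending_ind (P := fun k => (j < k)%N -> (W k <= _)%MS)) kq
  => [_|l lq IHl jl].
  by rewrite Wq sub0mx.
rewrite (submx_trans (WB l)) // addsmx_sub IHl ?leqW // andbT.
by apply/sub_kermxP/(BP (Ordinal lq)); rewrite -val_eqE gtn_eqF.
Qed.

Lemma satisfies_D_sub (K : fieldType) (n q : nat) (A B : {vspace 'M[K]_n}) :
  (A <= B)%VS -> satisfies_D q B -> satisfies_D q A.
Proof. by move=> /subvP AB DB x y xA yA; apply: DB => i; apply: AB. Qed.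

(** * Invariance under conjugation *)

Section Conjugation.

Variables (K : fieldType) (n : nat) (X : 'M[K]_n).
Hypothesis uX : X \in unitmx.
Implicit Types A B : {vspace 'M[K]_n}.

Lemma mem_conj_unit A M : (M \in conj_space X A) = (X *m M *m invmx X \in A).
Proof.
apply/idP/idP => [/mem_conj_space[N NA ->]|MA].
  by rewrite !mulmxA mulmxV // mul1mx mulmxK.
by apply/mem_conj_space; exists (X *m M *m invmx X);
   rewrite // !mulmxA mulVmx // mul1mx mulmxKV.
Qed.

Lemma conj_subalgebra A : is_subalgebra A -> is_subalgebra (conj_space X A).
Proof.
case=> A1 mulA; split=> [|x y]; first by rewrite mem_conj_unit mulmx1 mulmxV.
rewrite !mem_conj_unit => xA yA; move: (mulA _ _ xA yA).
by rewrite !mulmxA mulmxKV.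
Qed.

Lemma conj_satisfies_D q A : satisfies_D q A -> satisfies_D q (conj_space X A).
Proof.
move=> DA x y xA yA.
have xA' i : X *m x i *m invmx X \in A by rewrite -mem_conj_unit.
have yA' i : X *m y i *m invmx X \in A by rewrite -mem_conj_unit.
have E (c : 'I_q -> 'M[K]_n) :
  \prod_i (X *m c i *m invmx X) = X *m (\prod_i c i) *m invmx X.
  elim/big_ind2: _ => [|c1 c2 c3 c4 -> ->|//]; first by rewrite mulmx1 mulmxV.
  by rewrite -!mulmxE !mulmxA mulmxKV.
have := DA _ _ xA' yA'.
rewrite (eq_bigr (fun i => X *m commutator (x i) (y i) *m invmx X)).
  rewrite E => /(congr1 (fun Z => invmx X *m Z *m X)).
  by rewrite mulmx0 mul0mx !mulmxA mulVmx // mul1mx mulmxKV.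
move=> i _; rewrite /commutator mulmxBr mulmxBl; congr (_ - _);
  by rewrite !mulmxA mulmxKV.
Qed.

End Conjugation.

Lemma conj_spaceK (K : fieldType) (n : nat) (X : 'M[K]_n)
    (A : {vspace 'M[K]_n}) :
  X \in unitmx -> conj_space (invmx X) (conj_space X A) = A.
Proof.
move=> uX; apply/vspaceP => M; rewrite !mem_conj_unit ?unitmx_inv // invmxK.
by rewrite !mulmxA mulmxV // mul1mx mulmxK.
Qed.

Lemma conj_D_subalgebra (K : fieldType) (n q : nat) (X : 'M[K]_n)
    (A : {vspace 'M[K]_n}) :
  X \in unitmx -> is_D_subalgebra q A -> is_D_subalgebra q (conj_space X A).
Proof.
move=> uX [q1 algA DA nDA]; split=> //; first exact: conj_subalgebra.
  exact: conj_satisfies_D.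
(* The negative condition is transported by conjugating back. *)
move=> DXA; apply: nDA; rewrite -(conj_spaceK A uX).
by apply: conj_satisfies_D; rewrite ?unitmx_inv.
Qed.

Lemma conj_maximal_D (K : fieldType) (n q : nat) (X : 'M[K]_n)
    (A : {vspace 'M[K]_n}) :
  X \in unitmx -> is_maximal_D_subalgebra q A ->
  is_maximal_D_subalgebra q (conj_space X A).
Proof.
move=> uX [DA maxA]; split=> [|B DB /subvP AB]; first exact: conj_D_subalgebra.
have uX' : invmx X \in unitmx by rewrite unitmx_inv.
(* Conjugating [B] back gives a D_q algebra containing [A], to which the maximality of [A]
   applies. *)
rewrite -[B](conj_spaceK _ uX') invmxK; congr conj_space.
apply: maxA; first exact: conj_D_subalgebra.
apply/subvP => M MA; rewrite mem_conj_unit // invmxK; apply: AB.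
by rewrite mem_conj_unit // !mulmxA mulmxV // mul1mx mulmxK.
Qed.

(** * Block triangular form of a D_q subalgebra *)

Lemma exists_upper_conj (K : fieldType) (n q : nat) (A : {vspace 'M[K]_n}) :
  is_D_subalgebra q A ->
  exists2 X : 'M[K]_n, X \in unitmx &
  exists (d : 'I_q -> nat) (e : (\sum_i d i)%N = n),
  [/\ forall i, (0 < d i)%N,
      forall M, M \in conj_space X A ->
        forall i j : 'I_q, (j < i)%N -> block e M i j = 0
    & forall M N, M \in conj_space X A -> N \in conj_space X A ->
        forall i, block e (commutator M N) i i = 0].
Proof.
case=> q1 algA DA nDA.
have [d [Ed [e [X uX H]]]] := @adapted_conj K n q (comm_flag A) erefl
  (comm_flag_D DA) (comm_flag_decr algA).
exists X => //; exists d, e.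
split=> [i|_ /mem_conj_space[M MA ->] i j ji|].
(* An empty block would mean [W i <= W i.+1], against strict descent. *)
- rewrite Ed lt0n mxrank_eq0; apply/negP => /eqP E.
  apply/negP: (comm_flag_proper algA DA nDA (ltn_ord i)); rewrite negbK.
  by rewrite -(addsmx_diff_cap_eq (comm_flag A i) (comm_flag A i.+1)) E
    adds0mx capmxSr.
- by apply: (H _ _ _ i); rewrite ?ji ?comm_flag_stable // ltnW.
move=> M' N'; rewrite !mem_conj_unit // => MA NA i.
have E : invmx X *m commutator (X *m M' *m invmx X) (X *m N' *m invmx X) *m X
    = commutator M' N'.
  rewrite /commutator mulmxBr mulmxBl !mulmxA mulVmx // !mul1mx.
  by rewrite !mulmxKV.
(* Commutators send [W i] into [W i.+1], which kills the diagonal block as well. *)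
rewrite -E; apply: (H _ _ _ i.+1); first by rewrite ltnSn ltn_ord.
exact: comm_flag_commutator.
Qed.

(** * Block upper triangular algebras with prescribed diagonal blocks *)

Section UpperBlock.

Variables (K : fieldType) (n q : nat) (d : 'I_q -> nat).
Variable e : (\sum_i d i)%N = n.

(** Cutting it out by preimages and kernels of the linear block maps makes it a subspace by
    construction. *)
Definition upper_space (D : forall i, {vspace 'M[K]_(d i)}) :
    {vspace 'M[K]_n} :=
  ((\bigcap_i (linfun (block_at e i i) @^-1: D i)) :&:
   (\bigcap_(p : 'I_q * 'I_q | (p.2 < p.1)%N)
      lker (linfun (block_at e p.1 p.2))))%VS.

Lemma mem_upper_space D M :
  M \in upper_space D <->
  (forall i, block e M i i \in D i) /\
  (forall i j : 'I_q, (j < i)%N -> block e M i j = 0).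
Proof.
rewrite memv_cap !memvE; split=> [/andP[]|[MD M0]].
  move=> /subv_bigcapP MD /subv_bigcapP M0; split=> [i|i j ji].
    by have := MD i isT; rewrite -memvE -memv_preim lfunE.
  by have := M0 (i, j) ji; rewrite -memvE memv_ker lfunE => /eqP.
apply/andP; split; apply/subv_bigcapP; first move=> i _; last move=> [i j] /= ji.
  by rewrite -memvE -memv_preim lfunE; apply: MD.
by rewrite -memvE memv_ker lfunE; apply/eqP/M0.
Qed.

Variable D : forall i, {vspace 'M[K]_(d i)}.

Lemma upper_subalgebra :
  (forall i, is_subalgebra (D i)) -> is_subalgebra (upper_space D).
Proof.
move=> algD; split=> [|x y].
  apply/mem_upper_space; split=> [i|i j ji]; last first.
    by rewrite block1 // -val_eqE gtn_eqF.
  by rewrite block1_diag; case: (algD i).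
move=> /mem_upper_space[xD x0] /mem_upper_space[yD y0].
apply/mem_upper_space; split=> [i|i j ji].
  by rewrite block_mul_diag //; case: (algD i) => _; apply; [apply: xD | apply: yD].
by apply: (@block_mul_upper _ _ _ _ e _ _ 0 0) => [i' j'|i' j'|]; rewrite !addn0 //;
  auto.
Qed.

(** Since the diagonal blocks commute, each commutator is strictly block upper triangular, and a
    product of [q] such matrices vanishes because [j < i + q] always. *)
Lemma upper_satisfies_D :
  (forall i x y, x \in D i -> y \in D i -> x *m y = y *m x) ->
  satisfies_D q (upper_space D).
Proof.
move=> commD x y xU yU; apply: (block_eq0 (e := e)) => i j.
apply: block_prod_upper; last by rewrite (leq_trans (ltn_ord j)) ?leq_addl.
move=> l {}i {}j; rewrite addn1 ltnS.
move: (xU l) (yU l) => /mem_upper_space[xD x0] /mem_upper_space[yD y0].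
have mul0 (M N : 'M[K]_n) : (forall i j : 'I_q, (j < i)%N -> block e M i j = 0) ->
    (forall i j : 'I_q, (j < i)%N -> block e N i j = 0) ->
    (j < i)%N -> block e (M *m N) i j = 0.
  by move=> M0 N0 ji; apply: (@block_mul_upper _ _ _ _ e _ _ 0 0) =>
    [i' j'|i' j'|]; rewrite !addn0 //; auto.
rewrite -/(block_at e i j _) linearB /= /block_at.
rewrite leq_eqVlt => /predU1P[/val_inj ->|ji]; last by rewrite !mul0 // subr0.
by rewrite !block_mul_diag // (commD _ _ _ (xD i) (yD i)) subrr.
Qed.

End UpperBlock.

(** * Consequences of maximality *)

(** The failure of D_(q-1) passes from [A] to the larger algebra, so maximality applies to it. *)
Lemma maximal_D_upper (K : fieldType) (n q : nat) (d : 'I_q -> nat)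
    (e : (\sum_i d i)%N = n) (A : {vspace 'M[K]_n})
    (D : forall i, {vspace 'M[K]_(d i)}) :
  is_maximal_D_subalgebra q A -> (A <= upper_space e D)%VS ->
  (forall i, is_commutative_subalgebra (D i)) -> upper_space e D = A.
Proof.
move=> [[q1 algA DA nDA] maxA] AU commD; apply: maxA => //; split=> //.
- by apply: upper_subalgebra => i; case: (commD i).
- by apply: upper_satisfies_D => i; case: (commD i).
by move=> DU; apply: nDA; apply: satisfies_D_sub DU.
Qed.

Lemma maximal_D_type (K : fieldType) (n q : nat) (d : 'I_q -> nat)
    (e : (\sum_i d i)%N = n) (A : {vspace 'M[K]_n}) :
  is_maximal_D_subalgebra q A -> (forall i, 0 < d i)%N ->
  (forall M, M \in A -> forall i j : 'I_q, (j < i)%N -> block e M i j = 0) ->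
  (forall M N, M \in A -> N \in A ->
     forall i, block e (commutator M N) i i = 0) ->
  is_D_of_type_max_comm e A.
Proof.
move=> maxA d0 upA comA; have [[q1 algA DA nDA] _] := maxA.
pose D i := (linfun (block_at e i i) @: A)%VS.
have memD i x : reflect (exists2 M, M \in A & x = block e M i i) (x \in D i).
  by apply: (iffP memv_imgP) => -[M MA ->]; exists M; rewrite ?lfunE.
have commD i : is_commutative_subalgebra (D i).
  have mulD M N : M \in A -> N \in A ->
      block e (M *m N) i i = block e M i i *m block e N i i.
    by move=> MA NA; apply: block_mul_diag; apply: upA.
  split; first split=> [|_ _ /memD[M MA ->] /memD[N NA ->]].
  - by apply/memD; exists 1%:M; rewrite ?block1_diag //; case: algA.
  - apply/memD; exists (M *m N); first by case: algA => _; apply.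
    by rewrite mulD.
  move=> _ _ /memD[M MA ->] /memD[N NA ->]; apply/eqP; rewrite -subr_eq0 -!mulD //.
  by have := comA M N MA NA i; rewrite -/(block_at e i i _) linearB => ->.
(* Used for [D] itself and for [D] enlarged at one index. *)
have AU D' : (forall i, D i <= D' i)%VS -> (A <= upper_space e D')%VS.
  move=> /(_ _)/subvP DD'; apply/subvP => M MA; apply/mem_upper_space.
  by split=> [i|]; [apply: DD'; apply/memD; exists M | apply: upA].
have EA : upper_space e D = A by apply: maximal_D_upper => //; apply: AU.
split; first by case: maxA.
exists D; split; first split=> //.
- by move=> i; case: (commD i).
- by move=> M; rewrite -{1}EA; apply: mem_upper_space.
move=> i; split=> // C commC DC; apply/eqP; rewrite eqEsubv DC andbT.
pose D' := dfwith D C.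
have EA' : upper_space e D' = A.
  apply: maximal_D_upper => //; rewrite /D'; last by move=> j; case: dfwithP.
  by apply: AU => j; case: dfwithP => // *; apply: subvv.
apply/subvP => c cC.
(* The matrix with [c] as its block at [(i, i)] and zeros elsewhere lies in [upper_space e D' = A],
   so [c] is already a diagonal block of [A]. *)
have [M [Mdiag Moff]] := exists_diagonal e (dfwith (fun j => 0) c).
apply/memD; exists M; last by rewrite Mdiag dfwith_in.
rewrite -EA'; apply/mem_upper_space; split=> [j|j k kj].
  rewrite Mdiag /D'; have [<-|ij] := eqVneq i j.
    by rewrite !dfwith_in.
  by rewrite !dfwith_out // mem0v.
by rewrite Moff // -val_eqE gtn_eqF.
Qed.

Theorem theorem3p2 (K : fieldType) (n q : nat) (hn : (0 < n)%N) (hq : (1 < q)%N)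
    (A : {vspace 'M[K]_n}) (hA : is_maximal_D_subalgebra q A) :
  exists2 X : 'M[K]_n, X \in unitmx &
    exists (d : 'I_q -> nat) (e : (\sum_i d i)%N = n),
      is_D_of_type_max_comm e (conj_space X A).
Proof.
have [X uX [d [e [d0 upA comA]]]] := exists_upper_conj (proj1 hA).
exists X => //; exists d, e.
by apply: maximal_D_type => //; apply: conj_maximal_D.
Qed.
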